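(* Let $(\mathcal{C},\otimes,1)$ and $(\mathcal{D},\otimes,1')$ be monoidal categories, both having coequalizers and with every object coflat. Let $A$ be an algebra in $\mathcal{C}$ with unit $u_A:1\to A$, and let $(F:\mathcal{C}\to\mathcal{D},\phi^2,\phi^0)$ be a lax monoidal functor. (i) If $\phi^0$ is a split-epi and $-\otimes A:\mathcal{C}\to\mathcal{C}_A$ is semiseparable (resp., naturally full), then $-\otimes F(A):\mathcal{D}\to\mathcal{D}_{F(A)}$ is semiseparable (resp., naturally full). (ii) If $\phi^0$ is a split-mono and $-\otimes A:\mathcal{C}\to\mathcal{C}_A$ is separable, then $-\otimes F(A):\mathcal{D}\to\mathcal{D}_{F(A)}$ is separable.
   Context: Associativity and unit constraints are suppressed. An object $X$ is coflat if both $X\otimes-$ and $-\otimes X$ preserve coequalizers. For an algebra $(A,m_A,u_A)$ in a monoidal category $\mathcal{C}$, $\mathcal{C}_A$ is the category of right $A$-modules in $\mathcal{C}$, and the functor $-\otimes A:\mathcal{C}\to\mathcal{C}_A$ sends $M$ to $M\otimes A$ with right $A$-action $\mathrm{Id}_M\otimes m_A$. A lax monoidal functor $(F,\phi^2,\phi^0)$ has structure maps $\phi^2_{X,Y}:F(X)\otimes F(Y)\to F(X\otimes Y)$ (natural) and $\phi^0:1'\to F(1)$ satisfying the usual associativity and unit axioms. It sends the algebra $(A,m_A,u_A)$ in $\mathcal{C}$ to the algebra $(F(A),F(m_A)\phi^2_{A,A},F(u_A)\phi^0)$ in $\mathcal{D}$. A functor $F:\mathcal{A}\to\mathcal{B}$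 induces the natural transformation $\mathcal{F}:\mathrm{Hom}_{\mathcal{A}}(-,-)\to\mathrm{Hom}_{\mathcal{B}}(F-,F-)$, $f\mapsto F(f)$. $F$ is separable (resp. naturally full, semiseparable) if there is a natural transformation $\mathcal{P}:\mathrm{Hom}_{\mathcal{B}}(F-,F-)\to\mathrm{Hom}_{\mathcal{A}}(-,-)$ with $\mathcal{P}\circ\mathcal{F}=\mathrm{Id}$ (resp. $\mathcal{F}\circ\mathcal{P}=\mathrm{Id}$, $\mathcal{F}\circ\mathcal{P}\circ\mathcal{F}=\mathcal{F}$). *)

(* Defs.v *)
From Stdlib Require Import ProofIrrelevance.

Set Implicit Arguments.
Unset Strict Implicit.

Declare Scope cat_scope.
Delimit Scope cat_scope with cat.
Open Scope cat_scope.

Record Category := {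
  Ob :> Type;
  Hom : Ob -> Ob -> Type;
  idm : forall X, Hom X X;
  comp : forall X Y Z, Hom Y Z -> Hom X Y -> Hom X Z;
  comp_idl : forall X Y (f : Hom X Y), comp (idm Y) f = f;
  comp_idr : forall X Y (f : Hom X Y), comp f (idm X) = f;
  comp_assoc : forall X Y Z W (h : Hom Z W) (g : Hom Y Z) (f : Hom X Y),
    comp h (comp g f) = comp (comp h g) f
}.
Arguments Hom {c} _ _.
Arguments idm {c} X.
Arguments comp {c X Y Z} _ _.
Notation "g ∘ f" := (comp g f) (at level 40, left associativity) : cat_scope.

Definition is_split_epi (C : Category) (X Y : C) (f : Hom X Y) : Prop :=
  exists s : Hom Y X, f ∘ s = idm Y.

Definition is_split_mono (C : Category) (X Y : C) (f : Hom X Y) : Prop :=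
  exists r : Hom Y X, r ∘ f = idm X.

Definition is_coequalizer (C : Category) (X Y Q : C)
    (f g : Hom X Y) (q : Hom Y Q) : Prop :=
  q ∘ f = q ∘ g /\
  forall (Z : C) (h : Hom Y Z), h ∘ f = h ∘ g ->
    exists! k : Hom Q Z, k ∘ q = h.

Definition has_coequalizers (C : Category) : Prop :=
  forall (X Y : C) (f g : Hom X Y),
    exists (Q : C) (q : Hom Y Q), is_coequalizer f g q.

Record Functor (A B : Category) := {
  fob :> A -> B;
  fmap : forall X Y : A, Hom X Y -> Hom (fob X) (fob Y);
  fmap_id : forall X, fmap (idm X) = idm (fob X);
  fmap_comp : forall X Y Z (g : Hom Y Z) (f : Hom X Y),
    fmap (g ∘ f) = fmap g ∘ fmap f
}.
Arguments fmap {A B} F {X Y} _ : rename.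

Definition preserves_coequalizers (A B : Category) (F : Functor A B) : Prop :=
  forall (X Y Q : A) (f g : Hom X Y) (q : Hom Y Q),
    is_coequalizer f g q -> is_coequalizer (fmap F f) (fmap F g) (fmap F q).

(** Natural transformations Hom_B(F-,F-) -> Hom_A(-,-) of functors
    A^op x A -> Set, with the naturality square written out. *)
Record HomTrans (A B : Category) (F : Functor A B) := {
  ht_app :> forall X Y : A, Hom (F X) (F Y) -> Hom X Y;
  ht_natural : forall (X X' Y Y' : A) (a : Hom X' X) (b : Hom Y Y')
    (h : Hom (F X) (F Y)),
    ht_app (fmap F b ∘ h ∘ fmap F a) = b ∘ ht_app h ∘ a
}.
Arguments ht_app {A B F} P X Y _ : rename.

Definition separable (A B : Category) (F : Functor A B) : Prop :=
  exists P : HomTrans F,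
    forall (X Y : A) (f : Hom X Y), P X Y (fmap F f) = f.

Definition naturally_full (A B : Category) (F : Functor A B) : Prop :=
  exists P : HomTrans F,
    forall (X Y : A) (g : Hom (F X) (F Y)), fmap F (P X Y g) = g.

Definition semiseparable (A B : Category) (F : Functor A B) : Prop :=
  exists P : HomTrans F,
    forall (X Y : A) (f : Hom X Y), fmap F (P X Y (fmap F f)) = fmap F f.

Reserved Notation "X ⊗ Y" (at level 39, left associativity).
Reserved Notation "f ⊗₁ g" (at level 39, left associativity).

Record MonoidalCategory := {
  mcat :> Category;
  tens : mcat -> mcat -> mcat
    where "X ⊗ Y" := (tens X Y);
  tensm : forall X X' Y Y' : mcat,
    Hom X X' -> Hom Y Y' -> Hom (X ⊗ Y) (X' ⊗ Y')
    where "f ⊗₁ g" := (tensm f g);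
  one : mcat;
  assoc : forall X Y Z : mcat, Hom ((X ⊗ Y) ⊗ Z) (X ⊗ (Y ⊗ Z));
  assoc_inv : forall X Y Z : mcat, Hom (X ⊗ (Y ⊗ Z)) ((X ⊗ Y) ⊗ Z);
  lunit : forall X : mcat, Hom (one ⊗ X) X;
  lunit_inv : forall X : mcat, Hom X (one ⊗ X);
  runit : forall X : mcat, Hom (X ⊗ one) X;
  runit_inv : forall X : mcat, Hom X (X ⊗ one);
  tensm_id : forall X Y : mcat, idm X ⊗₁ idm Y = idm (X ⊗ Y);
  tensm_comp : forall (X X' X'' Y Y' Y'' : mcat)
    (f' : Hom X' X'') (f : Hom X X') (g' : Hom Y' Y'') (g : Hom Y Y'),
    (f' ∘ f) ⊗₁ (g' ∘ g) = (f' ⊗₁ g') ∘ (f ⊗₁ g);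
  assoc_natural : forall (X X' Y Y' Z Z' : mcat)
    (f : Hom X X') (g : Hom Y Y') (h : Hom Z Z'),
    assoc X' Y' Z' ∘ ((f ⊗₁ g) ⊗₁ h) = (f ⊗₁ (g ⊗₁ h)) ∘ assoc X Y Z;
  lunit_natural : forall (X Y : mcat) (f : Hom X Y),
    lunit Y ∘ (idm one ⊗₁ f) = f ∘ lunit X;
  runit_natural : forall (X Y : mcat) (f : Hom X Y),
    runit Y ∘ (f ⊗₁ idm one) = f ∘ runit X;
  assoc_invl : forall X Y Z, assoc_inv X Y Z ∘ assoc X Y Z = idm _;
  assoc_invr : forall X Y Z, assoc X Y Z ∘ assoc_inv X Y Z = idm _;
  lunit_invl : forall X, lunit_inv X ∘ lunit X = idm _;
  lunit_invr : forall X, lunit X ∘ lunit_inv X = idm _;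
  runit_invl : forall X, runit_inv X ∘ runit X = idm _;
  runit_invr : forall X, runit X ∘ runit_inv X = idm _;
  pentagon : forall X Y Z W : mcat,
    assoc X Y (Z ⊗ W) ∘ assoc (X ⊗ Y) Z W =
    (idm X ⊗₁ assoc Y Z W) ∘ assoc X (Y ⊗ Z) W ∘ (assoc X Y Z ⊗₁ idm W);
  triangle : forall X Y : mcat,
    (idm X ⊗₁ lunit Y) ∘ assoc X one Y = runit X ⊗₁ idm Y
}.
Arguments tens {m} _ _.
Arguments tensm {m X X' Y Y'} _ _.
Arguments one {m}.
Arguments assoc {m} X Y Z.
Arguments assoc_inv {m} X Y Z.
Arguments lunit {m} X.
Arguments lunit_inv {m} X.
Arguments runit {m} X.
Arguments runit_inv {m} X.
Notation "X ⊗ Y" := (tens X Y) : cat_scope.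
Notation "f ⊗₁ g" := (tensm f g) : cat_scope.

Section Tensor.
Variable C : MonoidalCategory.

Lemma tensm_compl (X Y Z W : C) (g : Hom Y Z) (f : Hom X Y) :
  (g ∘ f) ⊗₁ idm W = (g ⊗₁ idm W) ∘ (f ⊗₁ idm W).
Proof. rewrite <- tensm_comp, comp_idl; reflexivity. Qed.

Lemma tensm_compr (X Y Z W : C) (g : Hom Y Z) (f : Hom X Y) :
  idm W ⊗₁ (g ∘ f) = (idm W ⊗₁ g) ∘ (idm W ⊗₁ f).
Proof. rewrite <- tensm_comp, comp_idl; reflexivity. Qed.

Definition ltensor (X : C) : Functor C C :=
  {| fob := fun Y : C => X ⊗ Y;
     fmap := fun Y Y' (f : Hom Y Y') => idm X ⊗₁ f;
     fmap_id := fun Y => tensm_id X Y;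
     fmap_comp := fun Y Y' Y'' g f => tensm_compr X g f |}.

Definition rtensor (X : C) : Functor C C :=
  {| fob := fun Y : C => Y ⊗ X;
     fmap := fun Y Y' (f : Hom Y Y') => f ⊗₁ idm X;
     fmap_id := fun Y => tensm_id Y X;
     fmap_comp := fun Y Y' Y'' g f => tensm_compl X g f |}.

Definition coflat (X : C) : Prop :=
  preserves_coequalizers (ltensor X) /\ preserves_coequalizers (rtensor X).

Lemma assoc_cancel (W X Y Z : C) (f g : Hom W ((X ⊗ Y) ⊗ Z)) :
  assoc X Y Z ∘ f = assoc X Y Z ∘ g -> f = g.
Proof.
intros H; rewrite <- (comp_idl f), <- (comp_idl g), <- (assoc_invl X Y Z).
rewrite <- !comp_assoc, H; reflexivity.
Qed.

Lemma tensm_one_inj (X Y : C) (f g : Hom X Y) :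
  f ⊗₁ idm one = g ⊗₁ idm one -> f = g.
Proof.
intros H; rewrite <- (comp_idr f), <- (comp_idr g), <- (runit_invr X).
rewrite !comp_assoc, <- !runit_natural, H; reflexivity.
Qed.

(** Kelly's coherence, a consequence of the pentagon and the triangle. *)
Lemma runit_tens (X Y : C) :
  (idm X ⊗₁ runit Y) ∘ assoc X Y one = runit (X ⊗ Y).
Proof.
apply tensm_one_inj, assoc_cancel; symmetry.
rewrite <- triangle, comp_assoc, <- tensm_id, assoc_natural.
rewrite <- comp_assoc, pentagon, !comp_assoc, <- tensm_compr, triangle.
rewrite tensm_compl, comp_assoc, assoc_natural; reflexivity.
Qed.

End Tensor.

Record Algebra (C : MonoidalCategory) := {
  alg :> C;
  amul : Hom (alg ⊗ alg) alg;
  aunit : Hom one alg;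
  amul_assoc : amul ∘ (amul ⊗₁ idm alg) =
    amul ∘ (idm alg ⊗₁ amul) ∘ assoc alg alg alg;
  amul_unitl : amul ∘ (aunit ⊗₁ idm alg) = lunit alg;
  amul_unitr : amul ∘ (idm alg ⊗₁ aunit) = runit alg
}.
Arguments amul {C} a.
Arguments aunit {C} a.

Section Modules.
Variables (C : MonoidalCategory) (A : Algebra C).

Record RModule := {
  rmod :> C;
  act : Hom (rmod ⊗ A) rmod;
  act_assoc : act ∘ (act ⊗₁ idm A) =
    act ∘ (idm rmod ⊗₁ amul A) ∘ assoc rmod A A;
  act_unit : act ∘ (idm rmod ⊗₁ aunit A) = runit rmod
}.

Definition is_linear (M N : RModule) (f : Hom M N) : Prop :=
  f ∘ act M = act N ∘ (f ⊗₁ idm A).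

Definition RModHom (M N : RModule) : Type := {f : Hom M N | is_linear f}.

Lemma RModHom_eq (M N : RModule) (f g : RModHom M N) :
  proj1_sig f = proj1_sig g -> f = g.
Proof.
destruct f as [f Hf], g as [g Hg]; simpl; intros E; subst g.
rewrite (proof_irrelevance _ Hf Hg); reflexivity.
Qed.

Lemma linear_id (M : RModule) : is_linear (M := M) (N := M) (idm M).
Proof. unfold is_linear; rewrite tensm_id, comp_idl, comp_idr; reflexivity. Qed.

Lemma linear_comp (M N P : RModule) (g : RModHom N P) (f : RModHom M N) :
  is_linear (M := M) (N := P) (proj1_sig g ∘ proj1_sig f).
Proof.
destruct f as [f Hf], g as [g Hg]; unfold is_linear in *; simpl.
rewrite <- comp_assoc, Hf, comp_assoc, Hg, <- comp_assoc, tensm_compl.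
reflexivity.
Qed.

Definition RMod : Category.
Proof.
refine {| Ob := RModule; Hom := RModHom;
  idm := fun M => exist _ (idm (M : C)) (linear_id M);
  comp := fun M N P g f => exist _ (proj1_sig g ∘ proj1_sig f) (linear_comp g f) |}.
- intros; apply RModHom_eq, comp_idl.
- intros; apply RModHom_eq, comp_idr.
- intros; apply RModHom_eq, comp_assoc.
Defined.

(** M ⊗ A with the action id_M ⊗ m_A. *)
Definition free_module (M : C) : RModule.
Proof.
refine {| rmod := M ⊗ A; act := (idm M ⊗₁ amul A) ∘ assoc M A A |}.
- rewrite tensm_compl, comp_assoc.
  rewrite <- (comp_assoc (idm M ⊗₁ amul A) (assoc M A A)), assoc_natural.
  rewrite comp_assoc, <- tensm_compr, amul_assoc.
  rewrite !tensm_compr, <- !comp_assoc; f_equal; f_equal.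
  rewrite (comp_assoc (assoc M A A)), <- tensm_id, assoc_natural.
  rewrite <- comp_assoc, pentagon, !comp_assoc; reflexivity.
- rewrite <- comp_assoc, <- tensm_id, assoc_natural.
  rewrite comp_assoc, <- tensm_compr, amul_unitr.
  apply runit_tens.
Defined.

Lemma free_linear (M N : C) (f : Hom M N) :
  is_linear (M := free_module M) (N := free_module N) (f ⊗₁ idm A).
Proof.
unfold is_linear; simpl.
rewrite <- (comp_assoc (idm N ⊗₁ amul A)), assoc_natural, tensm_id.
rewrite !comp_assoc, <- !tensm_comp, !comp_idl, !comp_idr; reflexivity.
Qed.

(** The functor - ⊗ A : C -> C_A. *)
Definition free_functor : Functor C RMod.
Proof.
refine {| fob := free_module : C -> RMod;
  fmap := fun M N (f : Hom M N) =>
    exist _ (f ⊗₁ idm A) (free_linear f)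
    : @Hom RMod (free_module M) (free_module N) |}.
- intros; apply RModHom_eq, tensm_id.
- intros; apply RModHom_eq, tensm_compl.
Defined.

End Modules.

Record LaxMonoidalFunctor (C D : MonoidalCategory) := {
  lfun :> Functor C D;
  phi2 : forall X Y : C, Hom (lfun X ⊗ lfun Y) (lfun (X ⊗ Y));
  phi0 : Hom (@one D) (lfun one);
  phi2_natural : forall (X X' Y Y' : C) (f : Hom X X') (g : Hom Y Y'),
    phi2 X' Y' ∘ (fmap lfun f ⊗₁ fmap lfun g) =
    fmap lfun (f ⊗₁ g) ∘ phi2 X Y;
  phi2_assoc : forall X Y Z : C,
    fmap lfun (assoc X Y Z) ∘ phi2 (X ⊗ Y) Z ∘ (phi2 X Y ⊗₁ idm (lfun Z)) =
    phi2 X (Y ⊗ Z) ∘ (idm (lfun X) ⊗₁ phi2 Y Z)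
      ∘ assoc (lfun X) (lfun Y) (lfun Z);
  phi2_unitl : forall X : C,
    fmap lfun (lunit X) ∘ phi2 one X ∘ (phi0 ⊗₁ idm (lfun X)) =
    lunit (lfun X);
  phi2_unitr : forall X : C,
    fmap lfun (runit X) ∘ phi2 X one ∘ (idm (lfun X) ⊗₁ phi0) =
    runit (lfun X)
}.
Arguments phi2 {C D} l X Y.
Arguments phi0 {C D} l.

(** The algebra F(A), with multiplication F(m_A) ∘ φ² and unit F(u_A) ∘ φ⁰. *)
Definition lax_algebra (C D : MonoidalCategory) (F : LaxMonoidalFunctor C D)
  (A : Algebra C) : Algebra D.
Proof.
refine {| alg := F A;
  amul := fmap F (amul A) ∘ phi2 F A A;
  aunit := fmap F (aunit A) ∘ phi0 F |}.
- rewrite tensm_compl, tensm_compr, <- (fmap_id F), <- !comp_assoc.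
  rewrite (comp_assoc (phi2 F A A)), (comp_assoc (phi2 F A A)), !phi2_natural.
  rewrite <- !comp_assoc, (comp_assoc (fmap F (amul A))).
  rewrite (comp_assoc (fmap F (amul A)) (fmap F (idm A ⊗₁ amul A))).
  rewrite <- !fmap_comp, amul_assoc, fmap_comp, <- comp_assoc; f_equal.
  rewrite !comp_assoc, (fmap_id F); apply phi2_assoc.
- rewrite tensm_compl, <- (fmap_id F), <- comp_assoc.
  rewrite (comp_assoc (phi2 F A A)), phi2_natural.
  rewrite !comp_assoc, <- fmap_comp, amul_unitl, (fmap_id F).
  apply phi2_unitl.
- rewrite tensm_compr, <- (fmap_id F), <- comp_assoc.
  rewrite (comp_assoc (phi2 F A A)), phi2_natural.
  rewrite !comp_assoc, <- fmap_comp, amul_unitr, (fmap_id F).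
  apply phi2_unitr.
Defined.

(* Main.v *)
(** Writing u for the unit of A, the functor - ⊗ A is semiseparable (resp.
    naturally full, separable) if and only if there is t : A -> 1 with
    u t u = u (resp. u t = id, t u = id).  Indeed - ⊗ A is left adjoint to the
    forgetful functor, so a natural P : Hom(-⊗A, -⊗A) -> Hom(-,-) is determined
    by its values on the counits, of which only the one at 1 matters for t.
    If s is a section (resp. retraction) of φ⁰, then s F(t) is such a map
    for the unit F(u) φ⁰ of F(A). *)

From Stdlib Require Import Setoid.
Require Import Defs.

Set Implicit Arguments.
Unset Strict Implicit.

(** * Coherence of the unitors at the unit object *)

Section Coherence.
Variable C : MonoidalCategory.

Lemma tensm_interchange (X X' Y Y' : C) (f : Hom X X') (g : Hom Y Y') :
  (idm X' ⊗₁ g) ∘ (f ⊗₁ idm Y) = (f ⊗₁ idm Y') ∘ (idm X ⊗₁ g).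
Proof. rewrite <- !tensm_comp, !comp_idl, !comp_idr; reflexivity. Qed.

Lemma runit_inv_natural (X Y : C) (f : Hom X Y) :
  (f ⊗₁ idm one) ∘ runit_inv X = runit_inv Y ∘ f.
Proof.
rewrite <- (comp_idl (_ ∘ _)), <- (runit_invl Y), <- comp_assoc; f_equal.
rewrite comp_assoc, runit_natural, <- comp_assoc, runit_invr.
apply comp_idr.
Qed.

Lemma lunit_cancel (X Y : C) (f g : Hom X (one ⊗ Y)) :
  lunit Y ∘ f = lunit Y ∘ g -> f = g.
Proof.
intros H; rewrite <- (comp_idl f), <- (comp_idl g), <- (lunit_invl Y).
rewrite <- !comp_assoc, H; reflexivity.
Qed.

Lemma lunit_epi (X Y : C) (f g : Hom X Y) :
  f ∘ lunit X = g ∘ lunit X -> f = g.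
Proof.
intros H; rewrite <- (comp_idr f), <- (comp_idr g), <- (lunit_invr X).
rewrite !comp_assoc, H; reflexivity.
Qed.

Lemma runit_tensm_one (X : C) : runit X ⊗₁ idm one = runit (X ⊗ one).
Proof.
rewrite <- (comp_idl (_ ⊗₁ _)), <- (comp_idl (runit (X ⊗ one))).
rewrite <- (runit_invl X), <- !comp_assoc, runit_natural; reflexivity.
Qed.

(** Naturality of [lunit] reduces the claim to its image under [idm one ⊗₁ -]; precomposed with the
    associator, the two sides are compared by the triangle, [runit_tens] and [runit_tensm_one]. *)
Lemma lunit_one : lunit one = runit (@one C).
Proof.
apply lunit_epi; rewrite <- !lunit_natural; f_equal.
rewrite <- (comp_idr (idm _ ⊗₁ lunit _)), <- (comp_idr (idm _ ⊗₁ runit _)).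
rewrite <- (assoc_invr one one one), !comp_assoc; f_equal.
rewrite triangle, runit_tens; apply runit_tensm_one.
Qed.

End Coherence.

(** * The adjunction between free modules and the forgetful functor *)

Section FreeForgetAdjunction.
Variables (C : MonoidalCategory) (A : Algebra C).

Definition free_unit (M : C) : Hom M (M ⊗ A) :=
  (idm M ⊗₁ aunit A) ∘ runit_inv M.

Definition free_counit (M : RModule A) : RModHom (free_module A M) M :=
  exist _ (act M) (eq_sym (eq_trans (act_assoc M) (eq_sym (comp_assoc _ _ _)))).

Lemma tensm_of_fmap (M N : C) (f : Hom M N)
    (g : RModHom (free_module A M) (free_module A N)) :
  fmap (free_functor A) f = g -> f ⊗₁ idm A = proj1_sig g.
Proof. intros E; rewrite <- E; reflexivity. Qed.

Lemma free_unit_natural (M N : C) (f : Hom M N) :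
  (f ⊗₁ idm A) ∘ free_unit M = free_unit N ∘ f.
Proof.
unfold free_unit; rewrite comp_assoc, <- tensm_interchange.
rewrite <- comp_assoc, runit_inv_natural; apply comp_assoc.
Qed.

Lemma free_unit_one : lunit A ∘ free_unit one = aunit A.
Proof.
unfold free_unit; rewrite comp_assoc, lunit_natural, <- comp_assoc, lunit_one.
rewrite runit_invr; apply comp_idr.
Qed.

Lemma act_free_unit (M : RModule A) : act M ∘ free_unit M = idm (M : C).
Proof.
unfold free_unit; rewrite comp_assoc, act_unit; apply runit_invr.
Qed.

(** A triangle identity of the adjunction; it comes from the left unit law of [A] and the triangle
    axiom. *)
Lemma act_free_unit_tens (M : C) :
  act (free_module A M) ∘ (free_unit M ⊗₁ idm A) = idm (M ⊗ A).
Proof.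
unfold free_unit; simpl.
rewrite tensm_compl, comp_assoc, <- (comp_assoc (idm M ⊗₁ amul A)).
rewrite assoc_natural, comp_assoc, <- tensm_compr, amul_unitl, triangle.
rewrite <- tensm_compl, runit_invr; apply tensm_id.
Qed.

(** Linearity moves [g] past the action, and the triangle identity [act_free_unit_tens] finishes. *)
Lemma free_transpose (M : C) (N : RModule A)
    (g : RModHom (free_module A M) N) :
  act N ∘ ((proj1_sig g ∘ free_unit M) ⊗₁ idm A) = proj1_sig g.
Proof.
destruct g as [g Hg]; cbn [proj1_sig]; unfold is_linear in Hg.
change (act N ∘ (@comp C M (free_module A M) N g (free_unit M) ⊗₁ idm A) = g).
rewrite tensm_compl, comp_assoc, <- Hg, <- comp_assoc.
change (g ∘ (act (free_module A M) ∘ (free_unit M ⊗₁ idm A)) = g).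
rewrite act_free_unit_tens; apply comp_idr.
Qed.

Lemma free_hom_ext (M : C) (N : RModule A)
    (g h : RModHom (free_module A M) N) :
  proj1_sig g ∘ free_unit M = proj1_sig h ∘ free_unit M -> g = h.
Proof.
intros E; apply RModHom_eq.
rewrite <- (free_transpose g), <- (free_transpose h), E; reflexivity.
Qed.

(** By [free_transpose], [g] is a counit after the free functor applied to a map [M -> N ⊗ A];
    naturality of [P] in its first variable pulls that map out. *)
Lemma HomTrans_free (P : HomTrans (free_functor A)) (M N : C)
    (g : @Hom (RMod A) (free_functor A M) (free_functor A N)) :
  P M N g =
  P (N ⊗ A) N (free_counit (free_module A N)) ∘ (proj1_sig g ∘ free_unit M).
Proof.
rewrite <- (comp_idl (P (N ⊗ A) N _)), <- ht_natural; f_equal.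
rewrite fmap_id, comp_idl; apply RModHom_eq; symmetry; apply free_transpose.
Qed.

Definition aunit_retract (P : HomTrans (free_functor A)) : Hom (A : C) one :=
  P (one ⊗ A) one (free_counit (free_module A one)) ∘ lunit_inv A.

Lemma aunit_retract_aunit (P : HomTrans (free_functor A)) :
  aunit_retract P ∘ aunit A = P one one (idm _).
Proof.
rewrite HomTrans_free; simpl; unfold aunit_retract.
rewrite comp_idl, <- free_unit_one, <- comp_assoc; f_equal.
rewrite comp_assoc, lunit_invl; apply comp_idl.
Qed.

Definition free_retract (t : Hom (A : C) one) (N : C) : Hom (N ⊗ A) N :=
  runit N ∘ (idm N ⊗₁ t).

Lemma free_retract_natural (t : Hom (A : C) one) (M N : C) (f : Hom M N) :
  free_retract t N ∘ (f ⊗₁ idm A) = f ∘ free_retract t M.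
Proof.
unfold free_retract; rewrite <- comp_assoc, tensm_interchange.
rewrite comp_assoc, runit_natural; symmetry; apply comp_assoc.
Qed.

Lemma free_retract_unit (t : Hom (A : C) one) (M : C) :
  free_retract t M ∘ free_unit M =
  runit M ∘ (idm M ⊗₁ (t ∘ aunit A)) ∘ runit_inv M.
Proof.
unfold free_retract, free_unit; rewrite tensm_compr, !comp_assoc.
reflexivity.
Qed.

(** [HomTrans_free] read backwards: the natural map [free_retract t] replaces the value of [P] on
    the counit. *)
Definition HomTrans_of (t : Hom (A : C) one) : HomTrans (free_functor A).
Proof.
refine {| ht_app := fun M N (g : Hom (free_functor A M) (free_functor A N)) =>
  free_retract t N ∘ proj1_sig g ∘ free_unit M : Hom M N |}.
intros; simpl.
rewrite !comp_assoc, free_retract_natural, <- comp_assoc, free_unit_natural.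
rewrite !comp_assoc; reflexivity.
Defined.

Lemma HomTrans_of_fmap (t : Hom (A : C) one) (M N : C) (f : Hom M N) :
  HomTrans_of t M N (fmap (free_functor A) f) =
  f ∘ (runit M ∘ (idm M ⊗₁ (t ∘ aunit A)) ∘ runit_inv M).
Proof.
simpl; rewrite free_retract_natural, <- comp_assoc, free_retract_unit.
reflexivity.
Qed.

(** * Criteria in terms of a map from [A] to the unit object *)

Lemma semiseparable_freeP :
  semiseparable (free_functor A) <->
  exists t : Hom (A : C) one, aunit A ∘ t ∘ aunit A = aunit A.
Proof.
split.
- intros [P HP]; exists (aunit_retract P).
  rewrite <- comp_assoc, aunit_retract_aunit.
  assert (E : P one one (idm _) ⊗₁ idm A = idm (one ⊗ A)).
  { pose proof (HP one one (idm one)) as E; rewrite fmap_id in E.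
    exact (tensm_of_fmap E). }
  (* Up to [lunit], [aunit A] is [free_unit one]; its naturality turns [P one one (idm _)] into the
     map that [E] makes trivial. *)
  rewrite <- free_unit_one at 1.
  rewrite <- comp_assoc, <- free_unit_natural, E, comp_idl.
  apply free_unit_one.
- intros [t Ht]; exists (HomTrans_of t).
  intros M N f; rewrite HomTrans_of_fmap, fmap_comp.
  rewrite <- (comp_idr (fmap (free_functor A) f)) at 2; f_equal.
  apply RModHom_eq; simpl; rewrite !tensm_compl.
  (* Since [lunit A] is multiplication by [aunit A], the relation [Ht] is absorbed after tensoring
     with [A]. *)
  assert (E : (t ∘ aunit A) ⊗₁ idm A = idm (one ⊗ A)).
  { apply lunit_cancel; rewrite comp_idr, <- amul_unitl, <- comp_assoc.
    rewrite <- tensm_compl, comp_assoc, Ht; reflexivity. }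
  assert (E' : (idm M ⊗₁ (t ∘ aunit A)) ⊗₁ idm A = idm ((M ⊗ one) ⊗ A)).
  { apply assoc_cancel; rewrite assoc_natural, E, tensm_id, comp_idl, comp_idr.
    reflexivity. }
  rewrite E', comp_idr, <- tensm_compl, runit_invr; apply tensm_id.
Qed.

Lemma naturally_full_freeP :
  naturally_full (free_functor A) <->
  exists t : Hom (A : C) one, aunit A ∘ t = idm (A : C).
Proof.
split.
- intros [P HP]; exists (aunit_retract P); apply lunit_epi.
  unfold aunit_retract; rewrite <- !comp_assoc, lunit_invl, comp_idr, comp_idl.
  (* Natural fullness at the counit makes [nu ⊗₁ idm A] the action, which [free_unit] splits. *)
  set (nu := P (one ⊗ A) one (free_counit (free_module A one))).
  assert (E : nu ⊗₁ idm A = act (free_module A one))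
    by exact (tensm_of_fmap (HP _ _ (free_counit _))).
  rewrite <- free_unit_one, <- comp_assoc, <- free_unit_natural, E.
  transitivity (lunit A ∘ idm (one ⊗ A)); [|apply comp_idr].
  f_equal; apply (act_free_unit (free_module A one)).
- intros [t Ht]; exists (HomTrans_of t).
  (* Along [free_unit M], naturality produces [idm N ⊗₁ (aunit A ∘ t)], an identity by [Ht]. *)
  intros M N g; apply free_hom_ext; simpl.
  rewrite free_unit_natural; unfold free_unit at 1, free_retract.
  rewrite !comp_assoc, <- (comp_assoc _ (runit_inv N)), runit_invl, comp_idr.
  rewrite <- tensm_compr, Ht, tensm_id, comp_idl; reflexivity.
Qed.

Lemma separable_freeP :
  separable (free_functor A) <->
  exists t : Hom (A : C) one, t ∘ aunit A = idm one.
Proof.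
split.
- intros [P HP]; exists (aunit_retract P).
  rewrite aunit_retract_aunit, <- fmap_id; apply HP.
- intros [t Ht]; exists (HomTrans_of t).
  intros M N f; rewrite HomTrans_of_fmap, Ht, tensm_id, comp_idr, runit_invr.
  apply comp_idr.
Qed.

End FreeForgetAdjunction.

Theorem proposition3p25 (C D : MonoidalCategory)
    (hC : has_coequalizers C) (hD : has_coequalizers D)
    (cC : forall X : C, coflat X) (cD : forall X : D, coflat X)
    (A : Algebra C) (F : LaxMonoidalFunctor C D) :
  (is_split_epi (phi0 F) ->
     (semiseparable (free_functor A) ->
        semiseparable (free_functor (lax_algebra F A))) /\
     (naturally_full (free_functor A) ->
        naturally_full (free_functor (lax_algebra F A)))) /\
  (is_split_mono (phi0 F) ->
     separable (free_functor A) ->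
     separable (free_functor (lax_algebra F A))).
Proof.
split.
- intros [s Hs]; split.
  + rewrite !semiseparable_freeP; intros [t Ht]; exists (s ∘ fmap F t); simpl.
    (* The inner [phi0 F ∘ s] cancels, so the relation for [t] applies under [F]. *)
    rewrite !comp_assoc, <- (comp_assoc _ (phi0 F)), Hs, comp_idr.
    rewrite <- !fmap_comp, Ht; reflexivity.
  + rewrite !naturally_full_freeP; intros [t Ht]; exists (s ∘ fmap F t); simpl.
    rewrite !comp_assoc, <- (comp_assoc _ (phi0 F)), Hs, comp_idr.
    rewrite <- fmap_comp, Ht; apply fmap_id.
- intros [s Hs]; rewrite !separable_freeP; intros [t Ht].
  exists (s ∘ fmap F t); simpl.
  (* Here [t ∘ aunit A] collapses first under [F], leaving [s ∘ phi0 F]. *)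
  rewrite !comp_assoc, <- (comp_assoc s), <- fmap_comp, Ht, fmap_id, comp_idr.
  exact Hs.
Qed.
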